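(* Let $\alpha\in\mathbb R$, $\alpha\neq0$, and let $h:\mathrm{Sym}_{++}(n)\to\mathbb R$ be a function. Define $F_\alpha:\mathrm{Sym}_{++}(n)\to\mathbb R$ by $F_\alpha(P):=h(P^{2\alpha})$. Then $h$ is geodesically convex with respect to the $\mathrm{AP}_{1/2}$-geometry if and only if $F_\alpha$ is geodesically convex with respect to the $\mathrm{AP}_\alpha$-geometry.
   Context: $\mathrm{Sym}_{++}(n)$ is the manifold of real symmetric positive definite $n\times n$ matrices, with each tangent space identified with the space $\mathrm{Sym}(n)$ of real symmetric matrices. Real powers, $\log$ and $\exp$ of matrices are defined by spectral calculus, and $(Df)(A)[E]$ denotes the Fréchet derivative of $f$ at $A$ in direction $E$. The $\mathrm{AP}_\alpha$-geometry (Alpha-Procrustes geometry) is $\mathrm{Sym}_{++}(n)$ with the Riemannian metric $g^{(\alpha)}$ defined as follows: for $P\in\mathrm{Sym}_{++}(n)$ and $Y\in\mathrm{Sym}(n)$, $\mathcal L_{P,\alpha}(Y)$ is the unique $H\in\mathrm{Sym}(n)$ with $$(D\exp)(\log P)\circ(D\log)(P^{2\alpha})[HP^{2\alpha}+P^{2\alpha}H]=Y,$$ and $g^{(\alpha)}_P(X,Y)=4\,\mathrm{tr}\big(\mathcal L_{P,\alpha}(X)\,P^{2\alpha}\,\mathcal L_{P,\alpha}(Y)\big)$. The case $\alpha=1/2$ is the Bures-Wasserstein geometry. For $P,Q\in\mathrm{Sym}_{++}(n)$, $\gamma^{\mathrm{AP}_\alpha}_{P,Q}:[0,1]\to\mathrm{Sym}_{++}(n)$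 is the distance-minimizing geodesic of $g^{(\alpha)}$ from $P$ to $Q$. A function $f:\mathrm{Sym}_{++}(n)\to\mathbb R$ is geodesically convex with respect to the $\mathrm{AP}_\alpha$-geometry if $f(\gamma^{\mathrm{AP}_\alpha}_{P,Q}(t))\le(1-t)f(P)+tf(Q)$ for all $P,Q\in\mathrm{Sym}_{++}(n)$ and $t\in[0,1]$. *)

(* Defs.v *)
(* MathComp-Analysis *)
From HB Require Import structures.
From mathcomp Require Import all_boot all_order all_algebra.
From mathcomp Require Import all_classical all_reals all_analysis.
Set Implicit Arguments.
Unset Strict Implicit.
Unset Printing Implicit Defensive.
Import Order.TTheory GRing.Theory Num.Theory.
Import numFieldNormedType.Exports.
Local Open Scope ring_scope.
Local Open Scope classical_set_scope.

(* Sym(n) is a type of its own, with the norm induced from 'M[R]_n, so that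
   'd f A is the Fréchet derivative of a map that is only meaningful on
   symmetric matrices. All norms on Sym(n) give the same derivatives. *)
Section Sym.
Variables (R : realType) (n : nat).

Definition symmx : {pred 'M[R]_n} := [pred A | A^T == A].

Lemma symmxP (A : 'M[R]_n) : reflect (A^T = A) (A \in symmx).
Proof. exact: eqP. Qed.

Fact symmx_submod_closed : submod_closed symmx.
Proof.
split=> [|a A B /symmxP hA /symmxP hB]; apply/symmxP; first by rewrite trmx0.
by rewrite linearP /= hA hB.
Qed.

HB.instance Definition _ :=
  GRing.isSubmodClosed.Build R 'M[R]_n symmx symmx_submod_closed.

Record sym : predArgType := Sym { symval :> 'M[R]_n ; _ : symval \in symmx }.

HB.instance Definition _ := [isSub for symval].
HB.instance Definition _ := [Choice of sym by <:].
HB.instance Definition _ := [SubChoice_isSubLmodule of sym by <:].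

Definition sym_norm (A : sym) : R := `|symval A|.

Fact ler_sym_normD (A B : sym) : sym_norm (A + B) <= sym_norm A + sym_norm B.
Proof. exact: ler_normD. Qed.

Fact sym_normZ (a : R) (A : sym) : sym_norm (a *: A) = `|a| * sym_norm A.
Proof. exact: normrZ. Qed.

Fact sym_norm0_eq0 (A : sym) : sym_norm A = 0 -> A = 0.
Proof. by move=> /normr0_eq0 A0; apply: val_inj. Qed.

HB.instance Definition _ :=
  Lmodule_isNormed.Build R sym ler_sym_normD sym_normZ sym_norm0_eq0.

End Sym.

Notation "''Sym[' R ]_ n" := (sym R n)
  (at level 8, n at level 2, format "''Sym[' R ]_ n").

Section SpectralCalculus.
Variables (R : realType) (n : nat).
Implicit Types (A P X Y H : 'Sym[R]_n) (f : R -> R).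

Definition spd : set 'Sym[R]_n :=
  [set P | forall v : 'rV[R]_n, v != 0 -> 0 < (v *m P *m v^T) 0 0].

Definition eigendecomp A : set ('M[R]_n * 'rV[R]_n) :=
  [set Ud | Ud.1 *m Ud.1^T = 1%:M /\
            symval A = Ud.1^T *m diag_mx Ud.2 *m Ud.1].

(* f(A) = U^T diag(f(d_i)) U for A = U^T diag(d_i) U with U orthogonal; the
   result does not depend on the decomposition that is selected, and the
   default (1, 0) is never reached. *)
Definition mxfun_val f A : 'M[R]_n :=
  let Ud := xget (1%:M, 0) (eigendecomp A) in
  Ud.1^T *m diag_mx (map_mx f Ud.2) *m Ud.1.

Fact mxfun_sym f A : mxfun_val f A \in @symmx R n.
Proof.
by apply/symmxP; rewrite /mxfun_val !trmx_mul trmxK tr_diag_mx mulmxA.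
Qed.

Definition mxfun f A : 'Sym[R]_n := Sym (mxfun_sym f A).

Definition mexp : 'Sym[R]_n -> 'Sym[R]_n := mxfun expR.
Definition mlog : 'Sym[R]_n -> 'Sym[R]_n := mxfun (@ln R).
Definition mpow P (p : R) : 'Sym[R]_n := mxfun (fun x => x `^ p) P.

Fact anticomm_sym (H A : 'Sym[R]_n) :
  symval H *m A + symval A *m H \in @symmx R n.
Proof.
apply/symmxP; rewrite linearD /= !trmx_mul.
by case: H A => [H /symmxP hH] [A /symmxP hA] /=; rewrite hH hA addrC.
Qed.

Definition anticomm H A : 'Sym[R]_n := Sym (anticomm_sym H A).

End SpectralCalculus.

Section AlphaProcrustes.
Variables (R : realType) (n : nat) (alpha : R).
Implicit Types (P Q X Y : 'Sym[R]_n) (c : R -> 'Sym[R]_n).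

Definition AP_L P Y : 'Sym[R]_n :=
  let A := mpow P (2 * alpha) in
  get [set H | 'd (@mexp R n) (mlog P) ('d (@mlog R n) A (anticomm H A)) = Y].

Definition AP_metric P X Y : R :=
  4 * \tr (symval (AP_L P X) *m mpow P (2 * alpha) *m AP_L P Y).

Definition AP_speed c (t : R) : R :=
  Num.sqrt (AP_metric (c t) (c^`() t) (c^`() t)).

Definition AP_length c : \bar R :=
  (\int[@lebesgue_measure R]_(t in `[0%R, 1%R]) (AP_speed c t)%:E)%E.

End AlphaProcrustes.

Section Geodesics.
Variables (R : realType) (n : nat).
Implicit Types (P Q : 'Sym[R]_n) (c : R -> 'Sym[R]_n).

(* C^1 on the closed interval: the velocity v extends continuously to the end
   points. Curves are total functions; only their values on [0, 1] matter. *)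
Definition C1_on (a b : R) c :=
  {within `[a, b], continuous c} /\
  exists v : R -> 'Sym[R]_n, {within `[a, b], continuous v} /\
    forall t, a < t < b -> is_derive t 1 c (v t).

Definition piecewise_C1 c := exists2 s : seq R, itv_partition 0 1 s &
  forall i, (i < size s)%N -> C1_on (nth 0 (0 :: s) i) (nth 0 s i) c.

Definition joins_in_spd P Q c :=
  [/\ c 0 = P, c 1 = Q & forall t, 0 <= t <= 1 -> spd (c t)].

Definition AP_dist (alpha : R) P Q : \bar R :=
  ereal_inf [set AP_length alpha c | c in
    [set c | joins_in_spd P Q c /\ piecewise_C1 c]].

(* Parametrised proportionally to arc length, with length equal to the
   Riemannian distance between the end points. *)
Definition AP_min_geodesic (alpha : R) P Q c :=
  [/\ joins_in_spd P Q c,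
      C1_on 0 1 c,
      exists k : R, forall t, 0 < t < 1 -> AP_speed alpha c t = k &
      AP_length alpha c = AP_dist alpha P Q].

Definition AP_convex (alpha : R) (f : 'Sym[R]_n -> R) :=
  forall P Q, spd P -> spd Q ->
  forall gamma, AP_min_geodesic alpha P Q gamma ->
  forall t, 0 <= t <= 1 -> f (gamma t) <= (1 - t) * f P + t * f Q.

End Geodesics.

(* Main.v *)
From HB Require Import structures.
Require Import Defs.
From mathcomp Require Import all_boot all_order all_algebra.
From mathcomp Require Import all_classical all_reals all_analysis.
From mathcomp Require Import ring lra.
From mathcomp Require Import measurable_realfun.
Import Order.TTheory GRing.Theory Num.Theory.
Import numFieldNormedType.Exports.
Local Open Scope ring_scope.
Local Open Scope classical_set_scope.
Set Implicit Arguments.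
Unset Strict Implicit.
Unset Printing Implicit Defensive.

(** Write phi P for the power P^(2 alpha), which maps the positive definite
    matrices bijectively onto themselves; its inverse is the power
    1/(2 alpha). The theorem holds because phi is a homothety from the
    AP_alpha metric to the AP_(1/2) metric. Indeed log (phi P) = 2 alpha log P,
    and D exp (log Q) is inverse to D log Q, so the equation that defines
    H = L_(P,alpha)(Y) reads

      H phi(P) + phi(P) H = D exp (log phi(P)) [D log P [Y]]
                          = (2 alpha)^-1 D phi (P) [Y],

    while for the parameter 1/2, at the point phi P and for the tangent vector
    D phi (P) [Y], the right-hand side is D phi (P) [Y] itself. Solutions of
    this Lyapunov equation are unique, hence the second solution is 2 alpha H
    (AP_L_homothety), the metric is multiplied by (2 alpha)^2, and speeds and
    lengths by |2 alpha|. Composition with phi therefore exchanges the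
    competing curves of the two geometries, their distances
    (AP_dist_homothety) and their minimizing geodesics
    (AP_min_geodesic_homothety), and convexity of h along phi o c is convexity
    of h o phi along c.

    The analytic input is that exp and log are C^1 on symmetric matrices, so
    that the chain rule applies and phi preserves piecewise C^1 curves. It rests
    on an exact identity. If A = sum_i a_i P_i and B = sum_j b_j Q_j are
    spectral decompositions, then

      f(B) - f(A) = sum_(i,j) f[a_i, b_j] P_i (B - A) Q_j

    with f[x, y] the divided difference (doi_sub). A sum
    sum_(i,j) theta(a_i, b_j) P_i E Q_j is a Lipschitz function of A and of B as
    soon as theta is Lipschitz in each variable (doi_lipschitz_r), for the same
    algebraic reason. So no eigenvector has to be followed along a perturbation:
    letting B tend to A gives the derivative of f at A
    and its Lipschitz dependence on A at once. The solution operator of the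
    Lyapunov equation is the sum with theta(x, y) = 1/(x + y).

    The existence of spectral decompositions is proved by maximizing
    tr (D U A U^T) over the orthogonal matrices U, for a diagonal D with distinct
    entries (real_spectral). *)

(** * Orthogonal diagonalization of real symmetric matrices *)

Section SpectralTheorem.
Variables (R : realType) (n : nat).
Implicit Types (A B G K U : 'M[R]_n).

(** The first-order condition at a maximum, for explicit polynomial
    variations. *)
Lemma linear_le_quadratic_eq0 (x M : R) : 0 <= M ->
  (forall t, `|t| <= 1 -> t * x <= t ^+ 2 * M) -> x = 0.
Proof.
move=> M0 tx; have c0 : 0 < M + `|x| + 1 by rewrite ltr_wpDl// addr_ge0.
(* The test value t = x / (M + |x| + 1) turns the inequality into
   x^2 (|x| + 1) <= 0. *)
have t1 : `|x / (M + `|x| + 1)| <= 1.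
  rewrite normrM normfV (gtr0_norm c0) ler_pdivrMr// mul1r; lra.
have := tx _ t1; rewrite expr_div_n mulrAC -mulrAC -subr_ge0 => h.
have /eqP : x ^+ 2 = 0.
  apply/eqP; rewrite eq_le sqr_ge0 andbT leNgt; apply/negP => x20.
  move: h; rewrite leNgt => /negP; apply.
  rewrite (_ : _ - _ = - (x ^+ 2 * (`|x| + 1) / (M + `|x| + 1) ^+ 2)); last first.
    by field; rewrite gt_eqF.
  by rewrite oppr_lt0 divr_gt0 ?exprn_gt0// mulr_gt0// ltr_wpDl.
by rewrite sqrf_eq0 => /eqP.
Qed.

Definition skew (i j : 'I_n) : 'M[R]_n := delta_mx i j - delta_mx j i.

Lemma tr_skew i j : (skew i j)^T = - skew i j.
Proof. by rewrite /skew linearB /= !trmx_delta opprB. Qed.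

Lemma skew_sq i j : i != j ->
  skew i j *m skew i j = - (delta_mx i i + delta_mx j j).
Proof.
move=> ij; rewrite /skew !mulmxBl !mulmxBr.
rewrite !mul_delta_mx_cond !(eqxx, eq_sym j i, negbTE ij)/= !mulr0n !mulr1n.
by rewrite sub0r subr0 opprD addrC.
Qed.

Lemma skew_cube i j : i != j ->
  skew i j *m (skew i j *m skew i j) = - skew i j.
Proof.
move=> ij; rewrite skew_sq// mulmxN mulmxDr /skew !mulmxBl.
rewrite !mul_delta_mx_cond !(eqxx, eq_sym j i, negbTE ij)/= !mulr0n !mulr1n.
by rewrite sub0r subr0 addrC.
Qed.

(** Rodrigues' formula 1 + sin K + (1 - cos) K^2 for the rotation in the plane
    of the i-th and j-th axes, with sin = 2 t / (1 + t^2) and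
    cos = (1 - t^2) / (1 + t^2): a rational parametrization by t. *)
Definition rotation i j (t : R) : 'M[R]_n :=
  1%:M + (2 * t / (1 + t ^+ 2)) *: skew i j
       + (2 * t ^+ 2 / (1 + t ^+ 2)) *: (skew i j *m skew i j).

Lemma tr_rotation i j t : (rotation i j t)^T =
  1%:M - (2 * t / (1 + t ^+ 2)) *: skew i j
       + (2 * t ^+ 2 / (1 + t ^+ 2)) *: (skew i j *m skew i j).
Proof.
rewrite /rotation; move: (skew i j) (tr_skew i j) => K tK.
by rewrite !linearD/= !linearZ/= trmx_mul trmx1 tK mulmxN mulNmx opprK scalerN.
Qed.

(** Only K^3 = - K and sin^2 + cos^2 = 1 matter, the latter in the form
    s^2 = 2 u - u^2 for s = sin and u = 1 - cos. *)
Lemma rotation_orthogonal i j t : i != j ->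
  rotation i j t *m (rotation i j t)^T = 1%:M.
Proof.
move=> ij; rewrite tr_rotation /rotation.
move: (skew_cube ij); move: (skew i j) => K cube.
set s := (2 * t / _); set u := (2 * t ^+ 2 / _).
have t0 : 1 + t ^+ 2 != 0 by rewrite gt_eqF// ltr_pwDl// sqr_ge0.
have su : s ^+ 2 = 2 * u - u ^+ 2 by rewrite /s /u; field.
have cube' : K *m K *m K = - K by rewrite -mulmxA.
have quart : K *m K *m (K *m K) = - (K *m K) by rewrite mulmxA cube' mulNmx.
rewrite !(mulmxDl, mulmxDr, mul1mx, mulmx1, mulmxN) -!(scalemxAl, scalemxAr).
rewrite cube cube' quart !scalerN !scalerA -!expr2 su.
apply/matrixP => a b; rewrite !mxE; ring.
Qed.

(** Along a rotation u, s^2, s u and u^2 are all O(t^2), so the coefficient of s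
    is the first variation. *)
Lemma trace_rotation_expansion (D B K : 'M[R]_n) :
  exists c : 'rV[R]_4, forall s u : R, let L := K *m K in
    \tr (D *m ((1%:M + s *: K + u *: L) *m B *m (1%:M - s *: K + u *: L))) =
    \tr (D *m B) + s * (\tr (D *m (K *m B)) - \tr (D *m (B *m K)))
      + u * c 0 0 + s ^+ 2 * c 0 1 + s * u * c 0 2 + u ^+ 2 * c 0 3.
Proof.
pose b X Y := \tr (D *m (X *m B *m Y)).
have bl X Z t Y : b (X + t *: Z) Y = b X Y + t * b Z Y.
  by rewrite /b !mulmxDl mulmxDr linearD/= -!scalemxAl -scalemxAr linearZ.
have br X Y Z t : b X (Y + t *: Z) = b X Y + t * b X Z.
  by rewrite /b !mulmxDr linearD/= -!scalemxAr linearZ.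
pose L := K *m K.
pose c : 'rV[R]_4 := \row_k nth 0
  [:: b L 1%:M + b 1%:M L; - b K K; b K L - b L K; b L L] k.
exists c => s u; cbv zeta; rewrite -/L !mxE /=.
rewrite -[LHS]/(b _ _) -scaleNr !(bl, br).
have -> : \tr (D *m B) = b 1%:M 1%:M by rewrite /b mul1mx mulmx1.
have -> : \tr (D *m (K *m B)) = b K 1%:M by rewrite /b mulmx1.
have -> : \tr (D *m (B *m K)) = b 1%:M K by rewrite /b mul1mx.
move: (b _ _) (b _ _) (b _ _) (b _ _) (b _ _) (b _ _) => ? ? ? ? ? ?; ring.
Qed.

(** The first variation of tr (D U A U^T) under a rotation of the axes i and j
    sees exactly the off-diagonal entry B i j, as soon as D has distinct
    entries. *)
Lemma trace_skew_commutator i j (d : 'rV[R]_n) B : B^T = B ->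
  \tr (diag_mx d *m (skew i j *m B)) - \tr (diag_mx d *m (B *m skew i j))
  = 2 * (d 0 i - d 0 j) * B i j.
Proof.
move=> sB; have Bji : B j i = B i j by rewrite -{1}sB mxE.
have trd k l (M : 'M[R]_n) : \tr (delta_mx k l *m M) = M l k.
  rewrite /mxtrace (bigD1 k)//= big1 ?addr0 => [|a ak].
    rewrite mxE (bigD1 l)//= big1 ?addr0 ?mxE ?eqxx ?mul1r// => b bl.
    by rewrite mxE (negbTE bl) andbF mul0r.
  by rewrite mxE big1// => b _; rewrite mxE (negbTE ak) mul0r.
rewrite mxtrace_mulC -mulmxA [X in _ - X = _](_ : _ = \tr (skew i j *m (diag_mx d *m B))).
  rewrite /skew !mulmxBl !linearB/= !trd.
  rewrite mul_mx_diag mul_diag_mx !mxE Bji; ring.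
by rewrite mulmxA mxtrace_mulC.
Qed.

Lemma continuous_mxM (T : topologicalType) (F G : T -> 'M[R]_n) :
  (forall i j, continuous (fun x => F x i j)) ->
  (forall i j, continuous (fun x => G x i j)) ->
  forall i j, continuous (fun x => (F x *m G x) i j).
Proof.
move=> cF cG i j; rewrite (_ : (fun _ => _) = fun x => \sum_k F x i k * G x k j).
  apply: continuous_big => [|k _]; first exact: add_continuous.
  by move=> x; apply: cvgM; [exact: cF|exact: cG].
by apply/funext => x; rewrite mxE.
Qed.

Lemma orthogonal_entry_le1 U i j : U *m U^T = 1%:M -> `|U i j| <= 1.
Proof.
move=> /matrixP/(_ i i); rewrite !mxE eqxx mulr1n => UU.
rewrite -(@ler_pXn2r _ 2)// ?nnegrE// expr1n real_normK ?num_real// -UU.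
rewrite (bigD1 j)//= mxE -expr2 lerDl sumr_ge0// => k _.
by rewrite mxE -expr2 sqr_ge0.
Qed.

Lemma mx_norm_le m p (M : 'M[R]_(m, p)) e : 0 <= e ->
  (forall i j, `|M i j| <= e) -> `|M| <= e.
Proof.
by move=> e0 Me; rewrite [X in X <= _]mx_normrE; apply/bigmax_leP; split=> // ij _.
Qed.

Lemma mx_norm_ge m p (M : 'M[R]_(m, p)) i j : `|M i j| <= `|M|.
Proof.
by rewrite [X in _ <= X]mx_normrE; apply: (le_bigmax _ _ (i, j)).
Qed.

(** The orthogonal group is compact; it is handled as a set of row vectors of
    length n * n, to which the Heine-Borel theorem applies. *)
Lemma trace_orbit_max (D A : 'M[R]_n) : exists2 U, U *m U^T = 1%:M &
  forall V, V *m V^T = 1%:M ->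
    \tr (D *m (V *m A *m V^T)) <= \tr (D *m (U *m A *m U^T)).
Proof.
pose O := [set v : 'rV[R]_(n * n) | vec_mx v *m (vec_mx v)^T = 1%:M].
have cv i j : continuous (fun v : 'rV[R]_(n * n) => vec_mx v i j).
  rewrite (_ : (fun _ => _) = fun v : 'rV[R]_(n * n) => v 0 (mxvec_index i j)).
    exact: coord_continuous.
  by apply/funext => v; rewrite mxE.
have cvT i j : continuous (fun v : 'rV[R]_(n * n) => (vec_mx v)^T i j).
  rewrite (_ : (fun _ => _) = fun v : 'rV[R]_(n * n) => vec_mx v j i).
    exact: cv.
  by apply/funext => v; rewrite mxE.
have cst (M : 'M[R]_n) i j : continuous (fun v : 'rV[R]_(n * n) => M i j).
  exact: cst_continuous.
have Ocl : closed O.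
  rewrite (_ : O = \bigcap_(ij in [set: 'I_n * 'I_n]) (fun v : 'rV[R]_(n * n) =>
     (vec_mx v *m (vec_mx v)^T) ij.1 ij.2) @^-1` [set x | x = 1%:M ij.1 ij.2]).
    apply: closed_bigI => -[i j] _; apply: preimage_closed.
      by move=> v _; exact: (continuous_mxM cv cvT).
    exact: closed_eq.
  apply/seteqP; split=> v /=; first by move=> Ov [i j] _ /=; rewrite Ov.
  by move=> Ov; apply/matrixP => i j; exact: (Ov (i, j)).
have Obd : bounded_set O.
  exists 1; split=> // M M1 v Ov /=; rewrite (le_trans _ (ltW M1))//.
  apply: mx_norm_le => // i k; rewrite ord1 -[v]vec_mxK.
  by case/mxvec_indexP: k => k l; rewrite mxvecE orthogonal_entry_le1.
have [||v /set_mem Ov vmax] := @EVT_max_rV R _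
    (fun v => \tr (D *m (vec_mx v *m A *m (vec_mx v)^T))) O
    ^~ (bounded_closed_compact Obd Ocl).
- by exists (mxvec 1%:M); rewrite /O/= mxvecK trmx1 mulmx1.
- apply: continuous_subspaceT; rewrite /mxtrace.
  apply: continuous_big => [|k _]; first exact: add_continuous.
  do 3 apply: continuous_mxM => //.
exists (vec_mx v) => // V oV.
by have := vmax (mxvec V); rewrite mxvecK; apply; rewrite inE /O/= mxvecK.
Qed.

(** With D = diag (0, 1, ..., n - 1), a maximizer U of tr (D U A U^T) is
    stationary under all plane rotations, which forces every off-diagonal entry
    of U A U^T to vanish. *)
Theorem real_spectral A : A^T = A -> exists U (d : 'rV[R]_n),
  U *m U^T = 1%:M /\ A = U^T *m diag_mx d *m U.
Proof.
move=> sA; pose D := \row_(i < n) (i%:R : R).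
have [U oU Umax] := trace_orbit_max (diag_mx D) A.
pose B := U *m A *m U^T.
have oU' : U^T *m U = 1%:M by exact: mulmx1C.
have sB : B^T = B by rewrite /B !trmx_mul trmxK sA mulmxA.
suff Bd : B = diag_mx (\row_i B i i).
  exists U, (\row_i B i i); split=> //; rewrite -Bd /B.
  by rewrite !mulmxA oU' mul1mx -mulmxA oU' mulmx1.
apply/matrixP => i j; rewrite !mxE; have [<-|ij] := eqVneq i j; first by rewrite mulr1n.
rewrite mulr0n; pose x := 2 * (D 0 i - D 0 j) * B i j.
suff /eqP : x = 0.
  rewrite !mulf_eq0 pnatr_eq0/= subr_eq0 !mxE eqr_nat => /orP[|/eqP//].
  by move/eqP/val_inj => /eqP; rewrite (negbTE ij).
have [c cE] := trace_rotation_expansion (diag_mx D) B (skew i j).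
pose M := `|c 0 0| + 2 * `|c 0 1| + 2 * `|c 0 2| + 2 * `|c 0 3|.
apply: (@linear_le_quadratic_eq0 _ M) => [|t t1].
  by rewrite !addr_ge0// mulr_ge0.
have trB V : V *m U *m A *m (V *m U)^T = V *m B *m V^T.
  by rewrite /B trmx_mul !mulmxA.
have /Umax : rotation i j t *m U *m (rotation i j t *m U)^T = 1%:M.
  rewrite trmx_mul -mulmxA (mulmxA U) oU mul1mx; exact: rotation_orthogonal.
rewrite trB tr_rotation /rotation cE trace_skew_commutator// -/B -/x.
(* Now s = 2 t q and u = 2 t^2 q, and the inequality at the maximum is
   2 q (t x + t^2 w) <= 0 with w bounded by M. *)
pose q := (1 + t ^+ 2)^-1; rewrite -/q.
have t20 : 0 <= t ^+ 2 by exact: sqr_ge0.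
have q0 : 0 < q by rewrite invr_gt0; lra.
have q1 : q <= 1 by rewrite invf_le1; lra.
pose w := c 0 0 + 2 * q * c 0 1 + 2 * (t * q) * c 0 2 + 2 * (t ^+ 2 * q) * c 0 3.
rewrite -!addrA gerDl (_ : _ + _ = (2 * q) * (t * x + t ^+ 2 * w)); last first.
  rewrite /w; ring.
rewrite pmulr_rle0 ?mulr_gt0// -lerBrDr sub0r -mulrN => h.
apply: (le_trans h); rewrite ler_wpM2l//.
have wl a y : `|a| <= 1 -> `|2 * a * y| <= 2 * `|y|.
  move=> a1; rewrite !normrM ger0_norm// -mulrA ler_wpM2l//.
  by rewrite ler_piMl.
have t21 : `|t ^+ 2| <= 1 by rewrite normrX exprn_ile1.
have q1' : `|q| <= 1 by rewrite gtr0_norm.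
rewrite (le_trans (ler_norm _))// normrN /w /M.
by rewrite !(le_trans (ler_normD _ _))// lerD ?(le_trans (ler_normD _ _))// ?lerD//
  ?(le_trans (ler_normD _ _))// ?lerD// wl// normrM mulr_ile1.
Qed.

End SpectralTheorem.

(** * Functions of the left and right multiplications by symmetric matrices *)

Section DoubleOperator.
Variables (R : realType) (n : nat).
Implicit Types (A B C : 'Sym[R]_n) (U V M E : 'M[R]_n) (th : R -> R -> R).

(** The decomposition that mxfun selects, so that mxfunE holds by
    computation. *)
Definition frame A : 'M[R]_n := (xget (1%:M, 0) (eigendecomp A)).1.
Definition eigs A : 'rV[R]_n := (xget (1%:M, 0) (eigendecomp A)).2.

Lemma frameP A : frame A *m (frame A)^T = 1%:M /\
  symval A = (frame A)^T *m diag_mx (eigs A) *m frame A.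
Proof.
have [|U [d Ud]] := @real_spectral R n A; first by apply/symmxP/valP.
rewrite /frame /eigs; case: xgetP => [[V b] /= _ //|/(_ (U, d))].
by case; exact: Ud.
Qed.

Lemma frameV A : frame A *m (frame A)^T = 1%:M.
Proof. by have [] := frameP A. Qed.

Lemma frameVl A : (frame A)^T *m frame A = 1%:M.
Proof. by apply: mulmx1C; exact: frameV. Qed.

Lemma frame_diag A : frame A *m A = diag_mx (eigs A) *m frame A.
Proof.
have [UU ->] := frameP A.
by rewrite !mulmxA UU mul1mx.
Qed.

Lemma frame_diagT A : A *m (frame A)^T = (frame A)^T *m diag_mx (eigs A).
Proof.
have [UU ->] := frameP A.
by rewrite -!mulmxA UU mulmx1.
Qed.

Lemma mxfunE f A : symval (mxfun f A) =
  (frame A)^T *m diag_mx (map_mx f (eigs A)) *m frame A.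
Proof. by []. Qed.

(** An intertwiner W of two diagonal matrices has W i j = 0 unless the i-th and
    j-th entries agree, so it also intertwines their images under f. This is
    why a function of a matrix does not depend on the decomposition. *)
Lemma map_intertwining f (W : 'M[R]_n) (a b : 'rV[R]_n) :
  W *m diag_mx b = diag_mx a *m W ->
  W *m diag_mx (map_mx f b) = diag_mx (map_mx f a) *m W.
Proof.
move=> WE; apply/matrixP => i j; move/matrixP/(_ i j): WE.
rewrite !mul_mx_diag !mul_diag_mx !mxE => h.
have [->|W0] := eqVneq (W i j) 0; first by rewrite mul0r mulr0.
suff -> : b 0 j = a 0 i by rewrite mulrC.
by apply: (mulfI W0); rewrite h mulrC.
Qed.

Lemma mxfun_eigendecomp f A U d : U *m U^T = 1%:M ->
  symval A = U^T *m diag_mx d *m U ->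
  symval (mxfun f A) = U^T *m diag_mx (map_mx f d) *m U.
Proof.
move=> UU Ad; rewrite mxfunE.
pose W := frame A *m U^T.
have oU : U^T *m U = 1%:M by exact: mulmx1C.
have WE : W *m diag_mx d = diag_mx (eigs A) *m W.
  by rewrite /W !mulmxA -frame_diag Ad !mulmxA -[in RHS]mulmxA UU mulmx1.
have WfE := map_intertwining f WE.
have WU : frame A = W *m U by rewrite /W -mulmxA oU mulmx1.
rewrite {2}WU [_ *m (W *m U)]mulmxA -[_ *m diag_mx _ *m W]mulmxA -WfE.
by rewrite /W !mulmxA frameVl mul1mx.
Qed.

(** The double operator integral sum_(i,j) th(a_i, b_j) P_i E Q_j, for the
    spectral projections P_i of A and Q_j of B: the function th of the commuting
    operators E |-> A E and E |-> E B, applied to E. *)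
Definition doi th A B E : 'M[R]_n :=
  (frame A)^T *m
  (\matrix_(i, j) (th (eigs A 0 i) (eigs B 0 j) *
                   (frame A *m E *m (frame B)^T) i j)) *m frame B.

Lemma frame_conjK A B E :
  (frame A)^T *m (frame A *m E *m (frame B)^T) *m frame B = E.
Proof. by rewrite !mulmxA frameVl mul1mx -mulmxA frameVl mulmx1. Qed.

(** The entries of frame A *m E *m (frame B)^T are coordinates in which every
    double operator sum over A and B is diagonal; doi_eq and doiK let one compute
    with them. *)
Lemma doi_eq th A B E M :
  (forall i j, th (eigs A 0 i) (eigs B 0 j) *
     (frame A *m E *m (frame B)^T) i j = (frame A *m M *m (frame B)^T) i j) ->
  doi th A B E = M.
Proof.
move=> h; rewrite -[RHS](frame_conjK A B) /doi; congr (_ *m _ *m _).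
by apply/matrixP => i j; rewrite mxE h.
Qed.

Lemma doiK th A B E i j : (frame A *m doi th A B E *m (frame B)^T) i j =
  th (eigs A 0 i) (eigs B 0 j) * (frame A *m E *m (frame B)^T) i j.
Proof.
rewrite /doi !mulmxA frameV mul1mx -[_ *m frame B *m _]mulmxA frameV mulmx1.
by rewrite mxE.
Qed.

Lemma doi_linear th A B : linear (doi th A B).
Proof.
move=> a E M; apply: doi_eq => i j.
rewrite !(mulmxDr, mulmxDl) -!(scalemxAl, scalemxAr).
move: (doiK th A B E i j) (doiK th A B M i j).
move: (_ *m E *m _) (_ *m M *m _) (_ *m doi _ _ _ E *m _) (_ *m doi _ _ _ M *m _).
by move=> ? ? ? ?; rewrite !mxE => -> ->; ring.
Qed.

Lemma tr_doi th A B E : (doi th A B E)^T = doi (fun x y => th y x) B A E^T.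
Proof.
apply/esym/doi_eq => i j.
rewrite (_ : _ *m (doi _ _ _ _)^T *m _ =
             (frame A *m doi th A B E *m (frame B)^T)^T); last first.
  by move: (doi _ _ _ _) => D; rewrite !trmx_mul trmxK mulmxA.
rewrite [RHS]mxE doiK; congr (_ * _).
rewrite -[frame B *m E^T *m _]trmxK [LHS]mxE; congr (_ _ _).
by rewrite !trmx_mul !trmxK mulmxA.
Qed.

(** In these coordinates B - A is (b_j - a_i) W i j and f(B) - f(A) is
    (f b_j - f a_i) W i j, where W = frame A *m (frame B)^T. *)
Lemma doi_sub th f A B : (forall x y, th x y * (y - x) = f y - f x) ->
  symval (mxfun f B) - mxfun f A = doi th A B (symval B - A).
Proof.
move=> thf; apply/esym/doi_eq => i j.
pose W := frame A *m (frame B)^T.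
have cBA : frame A *m (symval B - A) *m (frame B)^T =
    W *m diag_mx (eigs B) - diag_mx (eigs A) *m W.
  by rewrite mulmxBr mulmxBl frame_diag -!mulmxA frame_diagT /W !mulmxA.
have cf : frame A *m (symval (mxfun f B) - mxfun f A) *m (frame B)^T =
    W *m diag_mx (map_mx f (eigs B)) - diag_mx (map_mx f (eigs A)) *m W.
  rewrite !mxfunE mulmxBr mulmxBl !mulmxA frameV mul1mx.
  by rewrite -[_ *m frame B *m _]mulmxA frameV mulmx1 /W ?mulmxA.
rewrite cBA cf mul_mx_diag mul_diag_mx mul_mx_diag mul_diag_mx !mxE.
transitivity (th (eigs A 0 i) (eigs B 0 j) * (eigs B 0 j - eigs A 0 i) * W i j).
  by rewrite !mxE; ring.
by rewrite thf !mxE; ring.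
Qed.

Lemma doi_anticomm A (H : 'Sym[R]_n) :
  symval (anticomm H A) = doi +%R A A H.
Proof.
apply/esym/doi_eq => i j /=.
have -> : frame A *m (symval H *m A + symval A *m H) *m (frame A)^T =
    (frame A *m H *m (frame A)^T) *m diag_mx (eigs A)
    + diag_mx (eigs A) *m (frame A *m H *m (frame A)^T).
  by rewrite mulmxDr mulmxDl !mulmxA frame_diag -!mulmxA frame_diagT.
move: (_ *m H *m _) => X.
by rewrite mul_mx_diag mul_diag_mx !mxE; ring.
Qed.

End DoubleOperator.

(** * Lipschitz bounds for double operator sums *)

Section Bounds.
Variables (R : realType) (n : nat).
Implicit Types (A B C : 'Sym[R]_n) (U V M E : 'M[R]_n) (th : R -> R -> R).
Local Notation N := (n%:R : R).

Lemma mulmx_norm M E : `|M *m E| <= N * (`|M| * `|E|).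
Proof.
apply: mx_norm_le => [|i j]; first by rewrite !mulr_ge0.
rewrite mxE (le_trans (ler_norm_sum _ _ _))//.
apply: (le_trans (y := \sum_(k < n) (`|M| * `|E|))).
  by apply: ler_sum => k _; rewrite normrM ler_pM// mx_norm_ge.
by rewrite sumr_const card_ord mulr_natl.
Qed.

Lemma orthogonal_norm U : U *m U^T = 1%:M -> `|U| <= 1.
Proof. by move=> UU; apply: mx_norm_le => // i j; exact: orthogonal_entry_le1. Qed.

Lemma frame_norm A : `|frame A| <= 1.
Proof. exact/orthogonal_norm/frameV. Qed.

Lemma frame_normT A : `|(frame A)^T| <= 1.
Proof. by apply: orthogonal_norm; rewrite trmxK frameVl. Qed.

Lemma mulmx_norm_conj U M V : `|U| <= 1 -> `|V| <= 1 ->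
  `|U *m M *m V| <= N ^+ 2 * `|M|.
Proof.
move=> U1 V1; rewrite (le_trans (mulmx_norm _ _))// expr2 -mulrA ler_wpM2l//.
rewrite (le_trans (ler_piMr _ V1))// (le_trans (mulmx_norm _ _))//.
by rewrite ler_wpM2l// ler_piMl.
Qed.

Lemma doi_norm th A B E K : 0 <= K ->
  (forall i j, `|th (eigs A 0 i) (eigs B 0 j)| <= K) ->
  `|doi th A B E| <= N ^+ 4 * (K * `|E|).
Proof.
move=> K0 thK; rewrite (le_trans (mulmx_norm_conj _ (frame_normT _) (frame_norm _)))//.
rewrite (_ : N ^+ 4 * _ = N ^+ 2 * (K * (N ^+ 2 * `|E|))); last by ring.
rewrite ler_wpM2l ?exprn_ge0//; apply: mx_norm_le => [|i j].
  by rewrite !mulr_ge0.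
rewrite mxE normrM ler_pM// (le_trans (mx_norm_ge _ _ _))//.
exact: (mulmx_norm_conj _ (frame_norm _) (frame_normT _)).
Qed.

(** Expressed in the frames of A and C, the difference of the two sums has
    entries sum_j (th(a_i, b_j) - th(a_i, c_k)) X i j S j k, where S passes from
    the frame of B to that of C. The hypothesis produces the factor b_j - c_k,
    and (b_j - c_k) S j k is an entry of B - C. *)
Lemma doi_lipschitz_r th A B C E K : 0 <= K ->
  (forall i j k, `|th (eigs A 0 i) (eigs B 0 j) - th (eigs A 0 i) (eigs C 0 k)|
     <= K * `|eigs B 0 j - eigs C 0 k|) ->
  `|doi th A B E - doi th A C E| <= N ^+ 7 * (K * `|E| * `|symval B - C|).
Proof.
move=> K0 thK.
rewrite -[X in `|X|](frame_conjK A C).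
rewrite (le_trans (mulmx_norm_conj _ (frame_normT _) (frame_norm _)))//.
pose X := frame A *m E *m (frame B)^T; pose S := frame B *m (frame C)^T.
pose Z := frame B *m (symval B - C) *m (frame C)^T.
have ZE j k : Z j k = (eigs B 0 j - eigs C 0 k) * S j k.
  rewrite /Z mulmxBr mulmxBl frame_diag -!mulmxA frame_diagT !mulmxA.
  rewrite -mulmxA mul_diag_mx mul_mx_diag !mxE; ring.
have X_le : `|X| <= N ^+ 2 * `|E| by exact: (mulmx_norm_conj _ (frame_norm _) (frame_normT _)).
have Z_le : `|Z| <= N ^+ 2 * `|symval B - C| by exact: (mulmx_norm_conj _ (frame_norm _) (frame_normT _)).
rewrite (_ : N ^+ 7 * _ = N ^+ 2 * (N * (K * ((N ^+ 2 * `|E|) * (N ^+ 2 * `|symval B - C|))))); last by ring.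
rewrite ler_wpM2l ?exprn_ge0//; apply: mx_norm_le => [|i k].
  by rewrite !mulr_ge0.
rewrite mulmxBr mulmxBl mxE [X in _ + X]mxE doiK.
have -> : frame A *m doi th A B E *m (frame C)^T =
    (\matrix_(i, j) (th (eigs A 0 i) (eigs B 0 j) * X i j)) *m S.
  by rewrite /doi /S !mulmxA frameV mul1mx.
have -> : frame A *m E *m (frame C)^T = X *m S.
  by rewrite /X /S !mulmxA -(mulmxA _ _ (frame B)) frameVl mulmx1.
clearbody X S Z.
rewrite !mxE mulr_sumr -sumrB (le_trans (ler_norm_sum _ _ _))//.
apply: (le_trans (y := \sum_(j < n) (K * ((N ^+ 2 * `|E|) * (N ^+ 2 * `|symval B - C|))))); last first.
  by rewrite sumr_const card_ord mulr_natl.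
apply: ler_sum => j _; rewrite !mxE.
apply: (le_trans (y := K * (`|X i j| * `|Z j k|))).
  rewrite ZE -[X in X - _]mulrA -mulrBl !normrM.
  rewrite (_ : K * _ = K * `|eigs B 0 j - eigs C 0 k| * (`|X i j| * `|S j k|)).
    by rewrite ler_wpM2r ?mulr_ge0.
  by ring.
by rewrite ler_wpM2l// ler_pM// (le_trans (mx_norm_ge _ _ _)).
Qed.

Lemma mx_norm_tr M : `|M^T| = `|M|.
Proof.
apply/eqP; rewrite eq_le; apply/andP; split; apply: mx_norm_le => // i j.
  by rewrite mxE mx_norm_ge.
by have := mx_norm_ge M^T j i; rewrite mxE.
Qed.

Lemma doi_lipschitz_l th A B C E K : 0 <= K ->
  (forall i j k, `|th (eigs B 0 j) (eigs A 0 i) - th (eigs C 0 k) (eigs A 0 i)|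
     <= K * `|eigs B 0 j - eigs C 0 k|) ->
  `|doi th B A E - doi th C A E| <= N ^+ 7 * (K * `|E| * `|symval B - C|).
Proof.
move=> K0 thK; rewrite -mx_norm_tr linearB/= !tr_doi -[`|E|]mx_norm_tr.
exact: doi_lipschitz_r.
Qed.

(** Each eigenvalue of B is a weighted mean of the eigenvalues of A, with the
    squared entries of an orthogonal row as weights, plus a diagonal entry of
    the conjugated difference B - A. *)
Lemma eigs_shift A B l u : (forall i, l <= eigs A 0 i <= u) ->
  forall j, l - N ^+ 2 * `|symval B - A| <= eigs B 0 j <= u + N ^+ 2 * `|symval B - A|.
Proof.
move=> lu j; pose S := frame B *m (frame A)^T.
pose Z := frame B *m (symval B - A) *m (frame B)^T.
have Zj : `|Z j j| <= N ^+ 2 * `|symval B - A|.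
  by rewrite (le_trans (mx_norm_ge _ _ _))// (mulmx_norm_conj _ (frame_norm _) (frame_normT _)).
have bE : eigs B 0 j = \sum_i eigs A 0 i * S j i ^+ 2 + Z j j.
  have -> : \sum_i eigs A 0 i * S j i ^+ 2 = (S *m diag_mx (eigs A) *m S^T) j j.
    by rewrite mxE; apply: eq_bigr => i _; rewrite mul_mx_diag !mxE; ring.
  have -> : S *m diag_mx (eigs A) *m S^T = frame B *m A *m (frame B)^T.
    by have [_ ->] := frameP A; rewrite /S trmx_mul trmxK !mulmxA.
  have -> : eigs B 0 j = (frame B *m B *m (frame B)^T) j j.
    by rewrite frame_diag -mulmxA frameV mulmx1 mxE eqxx mulr1n.
  by rewrite /Z mulmxBr mulmxBl !mxE; ring.
have S1 : \sum_i S j i ^+ 2 = 1.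
  have : (S *m S^T) j j = 1.
    by rewrite /S trmx_mul trmxK mulmxA -(mulmxA (frame B)) frameVl mulmx1 frameV mxE eqxx.
  by rewrite mxE => <-; apply: eq_bigr => i _; rewrite [S^T _ _]mxE.
have lS : l <= \sum_i eigs A 0 i * S j i ^+ 2.
  rewrite -[l]mulr1 -S1 mulr_sumr; apply: ler_sum => i _.
  by rewrite ler_wpM2r ?sqr_ge0//; case/andP: (lu i).
have uS : \sum_i eigs A 0 i * S j i ^+ 2 <= u.
  rewrite -[leRHS]mulr1 -S1 mulr_sumr; apply: ler_sum => i _.
  by rewrite ler_wpM2r ?sqr_ge0//; case/andP: (lu i).
by move: Zj; rewrite ler_norml => /andP[Z1 Z2]; rewrite bE; apply/andP; split; lra.
Qed.

End Bounds.

(** * Divided differences *)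

Section DividedDifference.
Variable R : realType.
Implicit Types (f df : R -> R) (l u K x y z : R).

Definition divdiff f df x y := if x == y then df x else (f y - f x) / (y - x).

Lemma divdiffC f df x y : divdiff f df x y = divdiff f df y x.
Proof.
rewrite /divdiff eq_sym; case: eqVneq => [->//|xy].
by rewrite -(opprB (f x)) -(opprB x) invrN mulrNN.
Qed.

Lemma divdiffM f df x y : divdiff f df x y * (y - x) = f y - f x.
Proof.
rewrite /divdiff; case: eqVneq => [->|xy]; first by rewrite !subrr mulr0.
by rewrite divfK// subr_eq0 eq_sym.
Qed.

(** A divided difference is an increment over the unit interval of a function
    whose derivative at s is f'(x + s (y - x)), including on the diagonal.
    This replaces the integral formula for f[x, y]. *)
Lemma divdiff_primitive f df x y :
  (forall s : R, 0 <= s <= 1 -> is_derive (x + s * (y - x)) 1 f (df (x + s * (y - x)))) ->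
  exists2 phi : R -> R, phi 1 - phi 0 = divdiff f df x y &
    forall s : R, 0 <= s <= 1 -> is_derive s 1 phi (df (x + s * (y - x))).
Proof.
rewrite /divdiff => fdf; case: eqVneq => [->|xy].
  exists (fun s : R => s * df y); first by rewrite mul1r mul0r subr0.
  move=> s _; rewrite subrr mulr0 addr0.
  by apply: is_derive_eq; rewrite /= scaler0 add0r scaler1.
have yx0 : y - x != 0 by rewrite subr_eq0 eq_sym.
exists (fun s : R => f (x + s * (y - x)) * (y - x)^-1).
  by rewrite mul1r mul0r addr0 (addrC x) subrK mulrBl.
move=> s s01; have := fdf s s01 => dfs.
have dg : is_derive s 1 (fun s : R => x + s * (y - x)) (y - x).
  by apply: is_derive_eq => /=; rewrite add0r mul1r scaler0 add0r; exact: mulr1.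
have dh := @is_derive1_comp R f (fun s : R => x + s * (y - x)) s _ _ dfs dg.
have dk := @is_deriveM _ _ _ (cst (y - x)^-1) s 1 _ _ dh (is_derive_cst _ _ _).
apply: (is_derive_eq dk).
by rewrite scaler0 add0r [LHS]mulrC /cst -mulrA divff// mulr1.
Qed.

(** Apply the mean value theorem to the difference of the primitives for f[x, y]
    and f[x, z]: its derivative is a difference of values of f' at points at
    distance s |y - z|. *)
Lemma divdiff_lipschitz f df l u K : 0 <= K ->
  (forall x, l <= x <= u -> is_derive x 1 f (df x)) ->
  (forall x y, l <= x <= u -> l <= y <= u -> `|df x - df y| <= K * `|x - y|) ->
  forall x y z, l <= x <= u -> l <= y <= u -> l <= z <= u ->
  `|divdiff f df x y - divdiff f df x z| <= K * `|y - z|.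
Proof.
move=> K0 fdf dfK x y z xI yI zI.
have seg (s w : R) : 0 <= s <= 1 -> l <= w <= u -> l <= x + s * (w - x) <= u.
  by move=> /andP[s0 s1] /andP[lw wu]; case/andP: xI => lx xu; apply/andP; split; nra.
have [p py dp] := @divdiff_primitive f df x y (fun (s : R) s01 => fdf _ (seg s y s01 yI)).
have [q qz dq] := @divdiff_primitive f df x z (fun (s : R) s01 => fdf _ (seg s z s01 zI)).
have dpq (s : R) : 0 <= s <= 1 -> is_derive s 1 (fun s : R => p s - q s)
    (df (x + s * (y - x)) - df (x + s * (z - x))).
  by move=> s01; have := dp s s01; have := dq s s01 => ? ?; apply: is_deriveB.
have [||s] := @MVT_segment R (fun s : R => p s - q s)
    (fun s : R => df (x + s * (y - x)) - df (x + s * (z - x))) 0 1 ler01.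
- by move=> s; rewrite in_itv/= => /andP[s0 s1]; apply: dpq; rewrite !ltW.
- apply: derivable_within_continuous => s; rewrite in_itv/= => /dpq ds.
  exact: ex_derive.
rewrite in_itv/= subr0 mulr1 -py -qz => s01 h.
rewrite (_ : _ - _ = p 1 - q 1 - (p 0 - q 0)); last by ring.
rewrite h (le_trans (dfK _ _ (seg _ _ s01 yI) (seg _ _ s01 zI)))// ler_wpM2l//.
rewrite (_ : _ - _ = s * (y - z)); last by ring.
by rewrite normrM ler_piMl// ger0_norm; case/andP: s01.
Qed.

Lemma divdiff_expR_lipschitz l u x y z : l <= x <= u -> l <= y <= u -> l <= z <= u ->
  `|divdiff expR expR x y - divdiff expR expR x z| <= expR u * `|y - z|.
Proof.
apply: divdiff_lipschitz => [|{}x {}y]; first exact: expR_ge0.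
wlog xy : x y / x <= y => [hw hx hy|].
  have [xy|/ltW yx] := leP x y; first exact: hw.
  by rewrite distrC [`|x - y|]distrC; exact: hw.
move=> /andP[lx xu] /andP[ly yu].
have [|c] := @MVT_segment R expR expR x y xy.
  by apply: continuous_subspaceT => w; exact: continuous_expR.
rewrite in_itv/= => /andP[xc cy] h; rewrite distrC h normrM ger0_norm ?expR_ge0// [`|y - x|]distrC ler_wpM2r//.
by rewrite ler_expR (le_trans cy).
Qed.

Lemma divdiff_ln_lipschitz l u x y z : 0 < l ->
  l <= x <= u -> l <= y <= u -> l <= z <= u ->
  `|divdiff (@ln R) GRing.inv x y - divdiff (@ln R) GRing.inv x z| <= l ^- 2 * `|y - z|.
Proof.
move=> l0; apply: divdiff_lipschitz => [|w /andP[lw _]|].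
- by rewrite invr_ge0 exprn_ge0// ltW.
- by apply: is_derive1_ln; exact: lt_le_trans lw.
move=> {}x {}y /andP[lx _] /andP[ly _].
have x0 := lt_le_trans l0 lx; have y0 := lt_le_trans l0 ly.
rewrite (_ : _ - _ = (x * y)^-1 * (y - x)); last first.
  by field; rewrite !gt_eqF.
rewrite normrM distrC ler_wpM2r// gtr0_norm ?invr_gt0 ?mulr_gt0//.
by rewrite lef_pV2 ?posrE ?mulr_gt0 ?exprn_gt0// expr2 ler_pM// ltW.
Qed.

End DividedDifference.

(** * The derivative of a spectral function *)

Section SpectralDerivative.
Variables (R : realType) (n : nat).
Implicit Types (A B E Y : 'Sym[R]_n) (f df : R -> R) (l u K : R).
Local Notation N := (n%:R : R).

Lemma doi_sym th A E : (forall x y, th x y = th y x) ->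
  doi th A A E \in @symmx R n.
Proof.
move=> thC; apply/symmxP; rewrite tr_doi (symmxP _ (valP E)).
by congr doi; apply/funext => x; apply/funext => y.
Qed.

Definition dmxfun f df A E : 'Sym[R]_n := Sym (doi_sym A E (divdiffC f df)).

Lemma dmxfun_linear f df A : linear (dmxfun f df A).
Proof. by move=> a E Y; apply: val_inj; exact: doi_linear. Qed.

HB.instance Definition _ f df A :=
  GRing.isLinear.Build R 'Sym[R]_n 'Sym[R]_n *:%R (dmxfun f df A)
    (dmxfun_linear f df A).

Definition eigs_in l u A := forall i, l <= eigs A 0 i <= u.

Lemma near_eigs_in l u e A : 0 < e -> eigs_in l u A ->
  \forall B \near A, eigs_in (l - e) (u + e) B.
Proof.
move=> e0 luA; have c0 : 0 < N ^+ 2 + 1 by rewrite ltr_wpDl.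
near=> B => i; have /andP[lB Bu] := eigs_shift B luA i.
suff eB : N ^+ 2 * `|symval B - A| <= e by apply/andP; split; lra.
apply: (@le_trans _ _ ((N ^+ 2 + 1) * `|symval B - A|)).
  by rewrite ler_wpM2r// lerDl.
rewrite -ler_pdivlMl// -[X in X <= _]/(`|B - A|) distrC.
by near: B; apply: cvgr_dist_le => //; rewrite mulr_gt0// invr_gt0.
Unshelve. all: by end_near. Qed.

Definition divdiff_lipschitz_on f df l u K := forall x y z,
  l <= x <= u -> l <= y <= u -> l <= z <= u ->
  `|divdiff f df x y - divdiff f df x z| <= K * `|y - z|.

Section LipschitzDividedDifference.
Variables (f df : R -> R) (l u K : R).
Hypotheses (K0 : 0 <= K) (fK : divdiff_lipschitz_on f df l u K).

(** By doi_sub the remainder is the difference of the double operator sums over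
    (A, B) and over (A, A), both applied to B - A; so it is quadratic in
    B - A. *)
Lemma mxfun_remainder A B : eigs_in l u A -> eigs_in l u B ->
  `|mxfun f B - mxfun f A - dmxfun f df A (B - A)| <= N ^+ 7 * (K * `|B - A| * `|B - A|).
Proof.
move=> luA luB; rewrite -[X in X <= _]/(`|_ - _ - doi _ _ _ _|).
rewrite (doi_sub A B (divdiffM f df)); apply: doi_lipschitz_r => // i j k.
exact: fK.
Qed.

(** Change one of the two arguments at a time. *)
Lemma dmxfun_lipschitz A B E : eigs_in l u A -> eigs_in l u B ->
  `|dmxfun f df A E - dmxfun f df B E| <= 2 * (N ^+ 7 * (K * `|E| * `|A - B|)).
Proof.
move=> luA luB; rewrite -[X in X <= _]/(`|doi _ _ _ _ - doi _ _ _ _|).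
rewrite -(subrKA (doi (divdiff f df) A B E)) (le_trans (ler_normD _ _))// mulr_natl mulr2n.
rewrite lerD//.
  apply: doi_lipschitz_r => // i j k; exact: fK.
apply: doi_lipschitz_l => // i j k; rewrite divdiffC (divdiffC _ _ (eigs B 0 k)); exact: fK.
Qed.

Lemma dmxfun_continuous A : continuous (dmxfun f df A).
Proof.
pose M := \sum_i \sum_j `|divdiff f df (eigs A 0 i) (eigs A 0 j)|.
have M0 : 0 <= M by apply: sumr_ge0 => i _; apply: sumr_ge0.
have dM E : `|dmxfun f df A E| <= N ^+ 4 * (M * `|E|).
  apply: doi_norm => // i j; rewrite /M (bigD1 i)//= (bigD1 j)//= -addrA lerDl.
  by rewrite addr_ge0// ?sumr_ge0// => k _; rewrite sumr_ge0.
apply/linear_bounded_continuous/bounded_funP => r.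
exists (N ^+ 4 * (M * r)) => E Er; rewrite (le_trans (dM E))//.
by rewrite !ler_wpM2l.
Qed.

Lemma mxfun_littleo A : (\forall B \near A, eigs_in l u B) ->
  mxfun f \o shift A = cst (mxfun f A) + dmxfun f df A +o_ (0 : 'Sym[R]_n) id.
Proof.
move=> luA; apply/eqaddoP => e e0.
have c0 : 0 < N ^+ 7 * K + 1 by rewrite ltr_wpDl// mulr_ge0.
have luA0 := nbhs_singleton luA.
near=> E.
have luEA : eigs_in l u (E + A).
  by near: E; move: luA; rewrite (near_shift (0 : 'Sym[R]_n)) subr0.
have := mxfun_remainder luA0 luEA; rewrite addrK => EA.
rewrite (_ : (_ - _) E = mxfun f (E + A) - mxfun f A - dmxfun f df A E); last first.
  by rewrite -[RHS]addrA -opprD.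
rewrite (le_trans EA)// !mulrA ler_wpM2r//.
apply: (@le_trans _ _ ((N ^+ 7 * K + 1) * `|E|)).
  by rewrite ler_wpM2r// lerDl.
rewrite -ler_pdivlMl//; near: E; apply: nbhs0_le.
by rewrite mulr_gt0// invr_gt0.
Unshelve. all: by end_near. Qed.

Lemma diff_mxfun A : (\forall B \near A, eigs_in l u B) ->
  'd (mxfun f) A = dmxfun f df A :> ('Sym[R]_n -> 'Sym[R]_n).
Proof.
move=> luA; apply: diff_unique; first exact: dmxfun_continuous.
exact: mxfun_littleo.
Qed.

Lemma differentiable_mxfun A : (\forall B \near A, eigs_in l u B) ->
  differentiable (mxfun f : 'Sym[R]_n -> 'Sym[R]_n) A.
Proof.
move=> luA; apply/diff_locallyP; rewrite diff_mxfun//; split.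
  exact: dmxfun_continuous.
exact: mxfun_littleo.
Qed.

(** The joint continuity of the derivative in base point and direction, for an
    arbitrary filter so as to cover one-sided limits at the ends of an
    interval. *)
Lemma cvg_diff_mxfun (T : Type) (F : set_system T) {FF : Filter F}
    (c v : T -> 'Sym[R]_n) A Y : (\forall B \near A, eigs_in l u B) ->
  c @ F --> A -> v @ F --> Y ->
  (fun t => 'd (mxfun f) (c t) (v t)) @ F --> 'd (mxfun f) A Y.
Proof.
move=> luA cA vY; rewrite diff_mxfun//.
have luA0 := nbhs_singleton luA.
pose k := 2 * (N ^+ 7 * K).
have dv : (fun t => dmxfun f df A (v t)) @ F --> dmxfun f df A Y.
  by apply: continuous_cvg vY; exact: dmxfun_continuous.
rewrite -[X in _ --> X]add0r.
rewrite (_ : (fun _ => _) = fun t => ('d (mxfun f) (c t) (v t) - dmxfun f df A (v t))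
   + dmxfun f df A (v t)); last by apply/funext => t; rewrite subrK.
apply: cvgD => //; apply/norm_cvg0P.
apply: (squeeze_cvgr (f := cst 0) (h := fun t => k * `|v t| * `|c t - A|)).
- near=> t; rewrite normr_ge0/= diff_mxfun; last first.
    by near: t; exact: (cA _ (near_join luA)).
  rewrite (le_trans (dmxfun_lipschitz _ _ _))//.
    by near: t; exact: (cA _ luA).
  by rewrite /k !mulrA.
- exact: cvg_cst.
rewrite -(mulr0 (k * `|Y|)); apply: cvgM.
  by apply: cvgM; [exact: cvg_cst|exact: cvg_norm].
apply/norm_cvg0P; apply/subr_cvg0.
exact: cA.
Unshelve. all: by end_near. Qed.

End LipschitzDividedDifference.
End SpectralDerivative.

(** * Exponential, logarithm and powers *)

Section ExpLog.
Variables (R : realType) (n : nat).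
Implicit Types (A B E P S Y H : 'Sym[R]_n) (U : 'M[R]_n) (d : 'rV[R]_n) (p q : R).

Lemma eigendecomp_spd A U d : U *m U^T = 1%:M ->
  symval A = U^T *m diag_mx d *m U -> (forall i, 0 < d 0 i) -> spd A.
Proof.
move=> UU AE d0 v v0; rewrite AE; pose w := v *m U^T.
have -> : v *m (U^T *m diag_mx d *m U) *m v^T = w *m diag_mx d *m w^T.
  by rewrite /w trmx_mul trmxK !mulmxA.
have w0 : w != 0.
  apply: contraNneq v0 => w0; rewrite -[v]mulmx1 -(mulmx1C UU) mulmxA.
  by rewrite -/w w0 mul0mx.
have dw i : (w *m diag_mx d) 0 i * w^T i 0 = d 0 i * w 0 i ^+ 2.
  by rewrite mul_mx_diag [X in X * _]mxE [w^T _ _]mxE; ring.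
rewrite mxE; under eq_bigr do rewrite dw.
have [i wi0] : exists i, w 0 i != 0.
  apply/existsP; apply: contraNT w0 => /existsPn w0; apply/eqP/rowP => i.
  by rewrite [RHS]mxE; apply/eqP; rewrite -[_ == _]negbK w0.
rewrite (bigD1 i)//= ltr_pwDl//.
  by rewrite mulr_gt0// exprn_even_gt0.
by apply: sumr_ge0 => j _; rewrite mulr_ge0 ?sqr_ge0// ltW.
Qed.

(** For the direct implication, the rows of the frame are unit eigenvectors. *)
Lemma spd_eigs_gt0 P : spd P <-> forall i, 0 < eigs P 0 i.
Proof.
have [UU PE] := frameP P; split=> [Ppd i|]; last exact: (eigendecomp_spd UU PE).
pose r := row i (frame P).
have rr : (r *m r^T) 0 0 = 1.
  have /matrixP/(_ i i) := UU; rewrite [RHS]mxE eqxx mulr1n => <-.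
  by rewrite !mxE; apply: eq_bigr => k _; rewrite !mxE.
have r0 : r != 0.
  by apply: contra_eqN rr => /eqP ->; rewrite mul0mx mxE eq_sym oner_eq0.
have := Ppd r r0; rewrite -row_mul frame_diag row_mul row_diag_mx.
by rewrite -scalemxAl -rowE -/r -scalemxAl mxE rr mulr1.
Qed.

Lemma mxfun_comp f g A : mxfun g (mxfun f A) = mxfun (g \o f) A.
Proof.
apply: val_inj; apply: etrans (mxfun_eigendecomp g (frameV A) (mxfunE f A)) _.
by rewrite -map_mx_comp.
Qed.

Lemma eq_mxfun f g A : (forall i, f (eigs A 0 i) = g (eigs A 0 i)) ->
  mxfun f A = mxfun g A.
Proof.
move=> fg; apply: val_inj.
apply: (congr1 (fun d => (frame A)^T *m diag_mx d *m frame A)).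
by apply/rowP => i; rewrite !mxE.
Qed.

Lemma mxfun_id A : mxfun id A = A.
Proof.
apply: val_inj; apply: etrans (mxfunE id A) _.
by rewrite map_mx_id//; have [_ <-] := frameP A.
Qed.

Lemma mxfunZ p f A : p *: mxfun f A = mxfun (fun x => p * f x) A.
Proof.
apply: val_inj; rewrite /= /mxfun_val -/(frame A) -/(eigs A).
rewrite scalemxAl scalemxAr; congr (_ *m _ *m _).
by apply/matrixP => i j; rewrite !mxE mulrnAr.
Qed.

Lemma mexp_spd S : spd (mexp S).
Proof.
apply: (eigendecomp_spd (frameV S) (mxfunE expR S)) => i.
by rewrite mxE expR_gt0.
Qed.

Lemma mexpK S : mlog (mexp S) = S.
Proof.
rewrite /mlog /mexp mxfun_comp -[RHS]mxfun_id.
by apply: eq_mxfun => i /=; rewrite expRK.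
Qed.

Lemma mlogK P : spd P -> mexp (mlog P) = P.
Proof.
move=> /spd_eigs_gt0 P0; rewrite /mlog /mexp mxfun_comp -[RHS]mxfun_id.
by apply: eq_mxfun => i /=; rewrite lnK ?posrE.
Qed.

Lemma mpowE P p : spd P -> mpow P p = mexp (p *: mlog P).
Proof.
move=> /spd_eigs_gt0 P0; rewrite /mexp /mlog mxfunZ mxfun_comp.
by apply: eq_mxfun => i /=; rewrite /powR gt_eqF.
Qed.

Lemma mpow_spd P p : spd P -> spd (mpow P p).
Proof. by move=> Ppd; rewrite mpowE//; exact: mexp_spd. Qed.

Lemma mlog_mpow P p : spd P -> mlog (mpow P p) = p *: mlog P.
Proof. by move=> Ppd; rewrite mpowE// mexpK. Qed.

Lemma mpowK P p q : p * q = 1 -> spd P -> mpow (mpow P p) q = P.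
Proof.
move=> pq Ppd; rewrite mpowE; last exact: mpow_spd.
by rewrite mlog_mpow// scalerA mulrC pq scale1r mlogK.
Qed.

Lemma mpow1 P : spd P -> mpow P 1 = P.
Proof. by move=> Ppd; rewrite mpowE// scale1r mlogK. Qed.

Lemma near_eigs_bounded A : exists l u, \forall B \near A, eigs_in l u B.
Proof.
exists (- `|eigs A| - 1), (`|eigs A| + 1); apply: near_eigs_in => // i.
by rewrite -ler_norml mx_norm_ge.
Qed.

Lemma near_eigs_gt0 P : spd P ->
  exists l u, 0 < l /\ \forall B \near P, eigs_in l u B.
Proof.
move=> /spd_eigs_gt0 P0; pose m := \big[Num.min/1]_i eigs P 0 i.
have m0 : 0 < m by exact: lt_bigmin.
exists (m - m / 2), (`|eigs P| + m / 2); split; first by lra.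
apply: near_eigs_in => [|i]; first by lra.
by rewrite bigmin_le/= (le_trans (ler_norm _))// mx_norm_ge.
Qed.

Lemma near_spd P : spd P -> \forall B \near P, spd B.
Proof.
move=> /near_eigs_gt0[l [u [l0 luP]]]; near=> B.
apply/spd_eigs_gt0 => i; apply: lt_le_trans l0 _.
by have /andP[] : l <= eigs B 0 i <= u by move: i; near: B.
Unshelve. all: by end_near. Qed.

Lemma differentiable_mexp S : differentiable (@mexp R n) S.
Proof.
have [l [u lu]] := near_eigs_bounded S.
by apply: (differentiable_mxfun (expR_ge0 u) _ lu); exact: divdiff_expR_lipschitz.
Qed.

Lemma differentiable_mlog P : spd P -> differentiable (@mlog R n) P.
Proof.
move=> /near_eigs_gt0[l [u [l0 lu]]].
apply: (@differentiable_mxfun _ _ _ GRing.inv l u (l ^- 2) _ _ _ lu).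
  by rewrite invr_ge0 exprn_ge0// ltW.
by move=> x y z; exact: divdiff_ln_lipschitz.
Qed.

Lemma cvg_diff_mexp (T : Type) (F : set_system T) {FF : Filter F}
    (c v : T -> 'Sym[R]_n) S Y : c @ F --> S -> v @ F --> Y ->
  (fun t => 'd (@mexp R n) (c t) (v t)) @ F --> 'd (@mexp R n) S Y.
Proof.
have [l [u lu]] := near_eigs_bounded S.
by apply: (cvg_diff_mxfun (expR_ge0 u) _ lu); exact: divdiff_expR_lipschitz.
Qed.

Lemma cvg_diff_mlog (T : Type) (F : set_system T) {FF : Filter F}
    (c v : T -> 'Sym[R]_n) P Y : spd P -> c @ F --> P -> v @ F --> Y ->
  (fun t => 'd (@mlog R n) (c t) (v t)) @ F --> 'd (@mlog R n) P Y.
Proof.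
move=> /near_eigs_gt0[l [u [l0 lu]]].
apply: (@cvg_diff_mxfun _ _ _ GRing.inv l u (l ^- 2) _ _ _ _ _ _ _ _ _ lu).
  by rewrite invr_ge0 exprn_ge0// ltW.
by move=> x y z; exact: divdiff_ln_lipschitz.
Qed.

Lemma diff_mlogK S Y : 'd (@mlog R n) (mexp S) ('d (@mexp R n) S Y) = Y.
Proof.
rewrite -[LHS]/((_ \o _) Y) -diff_comp; last 2 first.
- exact: differentiable_mexp.
- exact/differentiable_mlog/mexp_spd.
rewrite (_ : @mlog R n \o @mexp R n = id); first by rewrite diff_val.
by apply/funext => ?; exact: mexpK.
Qed.

(** mexp o mlog is the identity only on positive definite matrices, which is
    enough for the chain rule since they form a neighbourhood of P. *)
Lemma diff_mexpK P Y : spd P -> 'd (@mexp R n) (mlog P) ('d (@mlog R n) P Y) = Y.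
Proof.
move=> Ppd; have dlog := differentiable_mlog Ppd.
rewrite -[LHS]/((_ \o _) Y) -diff_comp//; last exact: differentiable_mexp.
rewrite -deriveE; last exact: differentiable_comp (differentiable_mexp _).
rewrite (@near_eq_derive _ _ _ _ id); first by rewrite derive_id.
by apply: filterS (near_spd Ppd) => B; exact: mlogK.
Qed.

End ExpLog.

(** * Scaling of integrals without measurability *)

Section NonmeasurableIntegral.
Context d (T : measurableType d) (R : realType).
Variable mu : {measure set T -> \bar R}.
Import HBNNSimple.
Local Open Scope ereal_scope.

Lemma sintegral_projC (h : {nnsfun T >-> R}) (N : set T) (mN : measurable N) :
  mu N = 0 -> sintegral mu (proj_nnsfun h (measurableC mN)) = sintegral mu h.
Proof.
move=> N0; rewrite -!integralT_nnsfun; apply: ge0_ae_eq_integral => //.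
- exact/measurable_EFinP.
- exact/measurable_EFinP.
- by move=> x _; rewrite lee_fin.
- by move=> x _; rewrite lee_fin.
exists N; split=> // x /= /not_implyP[_ hx]; apply: contrapT => Nx; apply: hx.
by rewrite mindicE mem_set ?mulr1.
Qed.

(** Speeds of curves are compared outside the finitely many break points only,
    and without any information on measurability. The integral of a nonnegative
    function is a supremum over simple functions below it, and a simple function
    may be set to zero on a null set without changing its integral. *)
Lemma le_integral_scale (D N : set T) (f g : T -> R) (k : R) :
  measurable N -> mu N = 0 -> (0 < k)%R ->
  (forall x, 0 <= f x)%R -> (forall x, 0 <= g x)%R ->
  (forall x, D x -> ~ N x -> g x <= k * f x)%R ->
  \int[mu]_(x in D) (g x)%:E <= k%:E * \int[mu]_(x in D) (f x)%:E.
Proof.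
move=> mN N0 k0 f0 g0 gf.
rewrite ge0_integralE//; last by move=> x _; rewrite lee_fin.
rewrite ge0_integralE//; last by move=> x _; rewrite lee_fin.
apply: ge_ereal_sup => _ [h /= hg <-].
have ki0 : (0 <= k^-1)%R by rewrite invr_ge0 ltW.
pose h' := scale_nnsfun (proj_nnsfun h (measurableC mN)) ki0.
have h'E : sintegral mu h' = k^-1%:E * sintegral mu h.
  by rewrite -(sintegral_projC h mN N0) -sintegralrM.
rewrite -lee_pdivrMl// -h'E; apply: ereal_sup_ubound; exists h' => //= x.
rewrite mindicE; have [Nx|Nx] := pselect (N x).
  rewrite memNset ?mulr0 ?mulr0; last by move=> /(_ Nx).
  by rewrite patchE; case: ifP => _; rewrite lee_fin.
rewrite mem_set// mulr1; have := hg x; rewrite !patchE.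
case: ifP => [/set_mem Dx|_]; rewrite !lee_fin => hx.
  by rewrite ler_pdivrMl// (le_trans hx)// gf.
by rewrite pmulr_rle0// invr_gt0.
Qed.

Lemma integral_scale (D N : set T) (f g : T -> R) (k : R) :
  measurable N -> mu N = 0 -> (0 < k)%R ->
  (forall x, 0 <= f x)%R -> (forall x, 0 <= g x)%R ->
  (forall x, D x -> ~ N x -> g x = k * f x)%R ->
  \int[mu]_(x in D) (g x)%:E = k%:E * \int[mu]_(x in D) (f x)%:E.
Proof.
move=> mN N0 k0 f0 g0 gf; apply/eqP; rewrite eq_le; apply/andP; split.
  by apply: (le_integral_scale mN N0) => // x Dx Nx; rewrite gf.
rewrite -lee_pdivlMl//; apply: (le_integral_scale mN N0) => //.
  by rewrite invr_gt0.
by move=> x Dx Nx; rewrite gf// mulKf// gt_eqF.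
Qed.

End NonmeasurableIntegral.

(** * The power map is a homothety *)

Section Lyapunov.
Variables (R : realType) (n : nat).
Implicit Types (A B E P S Y Z H : 'Sym[R]_n) (a p q alpha : R).

Lemma anticomm_inj A : spd A -> injective (fun H => anticomm H A).
Proof.
move=> /spd_eigs_gt0 A0 H1 H2 /(congr1 (@symval R n)).
rewrite !doi_anticomm => HE; apply: val_inj.
rewrite /= -[LHS](frame_conjK A A) -[RHS](frame_conjK A A).
congr (_ *m _ *m _); apply/matrixP => i j.
have a0 : eigs A 0 i + eigs A 0 j != 0 by rewrite gt_eqF// addr_gt0.
by apply: (mulfI a0); rewrite -!(doiK +%R A A _ i j) HE.
Qed.

(** H |-> H A + A H is the double operator sum with th(x, y) = x + y, so its
    inverse is the one with th(x, y) = 1 / (x + y). *)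
Lemma anticomm_surj A Z : spd A -> exists H, anticomm H A = Z.
Proof.
move=> /spd_eigs_gt0 A0.
have sC (x y : R) : (x + y)^-1 = (y + x)^-1 by rewrite addrC.
exists (Sym (doi_sym A Z sC)); apply: val_inj.
rewrite -[LHS]/(symval _) doi_anticomm/=; apply: doi_eq => i j.
by rewrite doiK mulrA divff ?mul1r// gt_eqF// addr_gt0.
Qed.

Lemma anticommZ a H A : anticomm (a *: H) A = a *: anticomm H A.
Proof. by apply: val_inj; rewrite /= scalerDr -scalemxAl -scalemxAr. Qed.

(** The equation that defines AP_L, solved for H A + A H. AP_L is a choice among
    the solutions of that equation; anticomm_surj shows that there is one. *)
Lemma anticomm_AP_L alpha P Y : spd P ->
  anticomm (AP_L alpha P Y) (mpow P (2 * alpha)) =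
  'd (@mexp R n) (mlog (mpow P (2 * alpha))) ('d (@mlog R n) P Y).
Proof.
move=> Ppd; set A := mpow P (2 * alpha).
have Apd : spd A by exact: mpow_spd.
have logexp (Q X : 'Sym[R]_n) : spd Q ->
    'd (@mlog R n) Q ('d (@mexp R n) (mlog Q) X) = X.
  by move=> Qpd; have := diff_mlogK (mlog Q) X; rewrite mlogK.
have LE : 'd (@mexp R n) (mlog P) ('d (@mlog R n) A (anticomm (AP_L alpha P Y) A)) = Y.
  have [H HE] := anticomm_surj ('d (@mexp R n) (mlog A) ('d (@mlog R n) P Y)) Apd.
  apply: (@getPex _ [set H | 'd (@mexp R n) (mlog P)
    ('d (@mlog R n) A (anticomm H A)) = Y]).
  by exists H => /=; rewrite HE logexp// diff_mexpK.
apply: (can_inj (fun Z => diff_mexpK Z Apd)).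
by rewrite logexp// -[LHS](logexp P)// LE.
Qed.

(** The derivative at P of the p-th power, seen as mexp (p *: mlog P). *)
Definition dmpow p P Y := 'd (@mexp R n) (p *: mlog P) (p *: 'd (@mlog R n) P Y).

(** For the parameter 1/2 the exponent is 1, so that the two differentials in
    the definition of AP_L cancel. *)
Lemma AP_L_homothety alpha P Y : spd P ->
  AP_L 2^-1 (mpow P (2 * alpha)) (dmpow (2 * alpha) P Y) =
  (2 * alpha) *: AP_L alpha P Y.
Proof.
move=> Ppd; set A := mpow P (2 * alpha).
have Apd : spd A by exact: mpow_spd.
have A1 : mpow A (2 * 2^-1) = A by rewrite divff ?pnatr_eq0// mpow1.
apply: (anticomm_inj Apd) => /=.
have := anticomm_AP_L 2^-1 (dmpow (2 * alpha) P Y) Apd.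
rewrite A1 diff_mexpK// => ->; rewrite anticommZ anticomm_AP_L//.
by rewrite /dmpow -mlog_mpow// linearZ.
Qed.

Lemma AP_metric_homothety alpha P Y : spd P ->
  AP_metric 2^-1 (mpow P (2 * alpha)) (dmpow (2 * alpha) P Y)
    (dmpow (2 * alpha) P Y) = (2 * alpha) ^+ 2 * AP_metric alpha P Y Y.
Proof.
move=> Ppd; rewrite /AP_metric AP_L_homothety// divff ?pnatr_eq0// mpow1; last exact: mpow_spd.
by rewrite /= -!scalemxAl -scalemxAr !linearZ/=; ring.
Qed.

End Lyapunov.

(** * Transport of curves and geodesics *)

Section Curves.
Variables (R : realType) (n : nat).
Implicit Types (P Q : 'Sym[R]_n) (c d : R -> 'Sym[R]_n) (p t : R).

(** Both equations are recorded so that the relation is symmetric under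
    inversion of p; nothing is required outside the unit interval, where a curve
    is arbitrary. *)
Definition mpow_related p c d := forall t, 0 <= t <= 1 ->
  [/\ spd (c t), spd (d t), d t = mpow (c t) p & c t = mpow (d t) p^-1].

Lemma mpow_related_sym p c d : mpow_related p c d -> mpow_related p^-1 d c.
Proof. by move=> cd t /cd[? ? ? ?]; split; rewrite ?invrK. Qed.

Lemma mpow_related_mpow p c : p != 0 ->
  (forall t, 0 <= t <= 1 -> spd (c t)) ->
  mpow_related p c (fun t => mpow (c t) p).
Proof.
move=> p0 cpd t /cpd ct; split=> //; first exact: mpow_spd.
by rewrite (mpowK _ ct)// divff.
Qed.

Lemma is_derive_mpow p c t v : spd (c t) -> is_derive t 1 c v ->
  is_derive t 1 (fun s => mexp (p *: mlog (c s))) (dmpow p (c t) v).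
Proof.
move=> ct dc.
have c1 : derivable c t 1 by exact: ex_derive.
have c2 : differentiable c t by exact/derivable1_diffP.
have vE : 'd c t 1 = v by rewrite -deriveE// derive_val.
have l2 : differentiable (@mlog R n \o c) t.
  by apply: differentiable_comp => //; exact: differentiable_mlog.
pose g := p *: (@mlog R n \o c).
have g2 : differentiable g t by exact: differentiableZ.
have e2 : differentiable (@mexp R n \o g) t.
  by apply: differentiable_comp => //; exact: differentiable_mexp.
apply: (@DeriveDef _ _ _ _ _ (@mexp R n \o g)); first exact/derivable1_diffP.
rewrite deriveE// diff_comp//; last exact: differentiable_mexp.
rewrite /= diffZ// -[LHS]/(_ (p *: _)) diff_comp//=; last exact: differentiable_mlog.
by rewrite vE.
Qed.

(** At an interior point the curve d agrees nearby with mexp (p *: mlog c); at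
    the end points it need not. *)
Lemma mpow_related_is_derive p c d t v : mpow_related p c d -> 0 < t < 1 ->
  is_derive t 1 c v -> is_derive t 1 d (dmpow p (c t) v).
Proof.
move=> cd /andP[t0 t1] dc.
have [ct _ _ _] : [/\ spd (c t), spd (d t), d t = mpow (c t) p & c t = mpow (d t) p^-1].
  by apply: cd; rewrite !ltW.
apply: (@near_eq_is_derive _ _ _ (fun s => mexp (p *: mlog (c s)))); last exact: is_derive_mpow.
near=> s; have [cs _ -> _] : [/\ spd (c s), spd (d s), d s = mpow (c s) p & c s = mpow (d s) p^-1].
  apply: cd; apply/andP; split; apply: ltW; near: s; first exact: lt_nbhsr.
  exact: lt_nbhsl.
by rewrite mpowE.
Unshelve. all: by end_near. Qed.

Lemma cvg_mlog (T : Type) (F : set_system T) {FF : Filter F} (e : T -> 'Sym[R]_n) P :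
  spd P -> e @ F --> P -> (fun x => mlog (e x)) @ F --> mlog P.
Proof.
move=> Ppd eP; apply: continuous_cvg eP.
exact/differentiable_continuous/differentiable_mlog.
Qed.

Lemma cvg_mexp (T : Type) (F : set_system T) {FF : Filter F} (e : T -> 'Sym[R]_n) P :
  e @ F --> P -> (fun x => mexp (e x)) @ F --> mexp P.
Proof.
move=> eP; apply: continuous_cvg eP.
exact/differentiable_continuous/differentiable_mexp.
Qed.

Lemma mpow_related_C1_on p c d (a b : R) : mpow_related p c d -> 0 <= a -> b <= 1 ->
  C1_on a b c -> C1_on a b d.
Proof.
move=> cd a0 b1 [cc [v [cv dv]]].
have in01 t : a <= t <= b -> 0 <= t <= 1.
  by move=> /andP[at_ tb]; rewrite (le_trans a0)// (le_trans tb).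
have plog t : a <= t <= b ->
    (fun s => p *: mlog (c s)) @ within `[a, b] (nbhs t) --> p *: mlog (c t).
  move=> tab; have [ct _ _ _] := cd t (in01 _ tab).
  apply: cvgZl_tmp; apply: cvg_mlog => //.
  by move/subspace_continuousP : cc; apply; rewrite /= in_itv.
split.
  apply: (@subspace_eq_continuous _ `[a, b] _ (fun s => mexp (p *: mlog (c s)))).
    move=> s /set_mem/=; rewrite in_itv/= => /in01/cd[cs _ dE _].
    by rewrite -[RHS]/(d s) dE mpowE.
  apply/subspace_continuousP => t /=; rewrite in_itv/= => tab.
  by apply: cvg_mexp; exact: plog.
exists (fun t => dmpow p (c t) (v t)); split; last first.
  move=> t tab; apply: (mpow_related_is_derive cd); last exact: dv.
  by case/andP: tab => at_ tb; rewrite (le_lt_trans a0)// (lt_le_trans tb).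
apply/subspace_continuousP => t /=; rewrite in_itv/= => tab.
have [ct _ _ _] := cd t (in01 _ tab).
have tab' : t \in `[a, b]%R by rewrite in_itv.
apply: cvg_diff_mexp; first exact: plog.
apply: cvgZl_tmp; apply: cvg_diff_mlog => //.
  by move/subspace_continuousP : cc; apply.
by move/subspace_continuousP : cv; apply.
Qed.

Lemma mpow_related_piecewise_C1 p c d : mpow_related p c d ->
  piecewise_C1 c -> piecewise_C1 d.
Proof.
move=> cd [s s01 cs]; exists s => // i si.
apply: (mpow_related_C1_on cd); last exact: cs.
  rewrite (set_nth_default 1)/=; last by rewrite ltnS ltnW.
  by apply: itv_partition_nth_ge s01; rewrite ltnS ltnW.
rewrite (set_nth_default 1)//.
by have := @itv_partition_nth_le _ _ 0 1 s i.+1 _ s01; apply.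
Qed.

(** Off the break points, a point lies in the interior of a piece, where a
    piecewise C^1 curve is differentiable. *)
Lemma itv_partition_piece (x y : R) (s : seq R) t : itv_partition x y s ->
  x <= t <= y -> t \notin x :: s ->
  exists2 i, (i < size s)%N & nth 0 (x :: s) i < t < nth 0 s i.
Proof.
elim: s x => [|z s IH] x /=.
  move/itv_partition_nil => <- /andP[xt tx]; rewrite inE => /negP[].
  by rewrite eq_le xt tx.
move=> xs /andP[xt ty]; rewrite inE negb_or => /andP[tx tzs].
have [tz|tz|tz] := ltgtP t z.
- by exists 0%N => //=; rewrite lt_neqAle eq_sym tx xt tz.
- have [||//|i si it] := IH z; first exact: itv_partition_cons xs.
    by rewrite ltW.
  by exists i.+1.
- by move: tzs; rewrite inE tz eqxx.
Qed.

Variable alpha : R.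
Hypothesis alpha0 : alpha != 0.

Let k : R := `|2 * alpha|.

Let k0 : 0 < k.
Proof. by rewrite normr_gt0 mulf_neq0// pnatr_eq0. Qed.

Lemma AP_speed_homothety c d t : mpow_related (2 * alpha) c d -> 0 < t < 1 ->
  derivable c t 1 -> AP_speed 2^-1 d t = k * AP_speed alpha c t.
Proof.
move=> cd t01 ct; have [cpd _ dE _] : [/\ spd (c t), spd (d t),
    d t = mpow (c t) (2 * alpha) & c t = mpow (d t) (2 * alpha)^-1].
  by apply: cd; case/andP: t01 => ? ?; rewrite !ltW.
have dc : is_derive t 1 c (c^`() t) by rewrite derive1E; exact: derivableP.
have dder := mpow_related_is_derive cd t01 dc.
rewrite /AP_speed [d^`() t]derive1E (@derive_val _ _ _ _ _ _ _ dder) dE.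
by rewrite AP_metric_homothety// sqrtrM ?sqr_ge0// sqrtr_sqr.
Qed.

Lemma AP_length_homothety c d : mpow_related (2 * alpha) c d ->
  piecewise_C1 c -> (AP_length 2^-1 d = k%:E * AP_length alpha c)%E.
Proof.
move=> cd [s s01 cs]; rewrite /AP_length.
apply: (@integral_scale _ _ R (@lebesgue_measure R) _ [set` 0 :: s]
  (AP_speed alpha c) (AP_speed 2^-1 d) k).
- by apply: countable_measurable => //; exact/finite_set_countable/finite_seq.
- by apply: countable_lebesgue_measure0; exact/finite_set_countable/finite_seq.
- exact: k0.
- by move=> t; exact: sqrtr_ge0.
- by move=> t; exact: sqrtr_ge0.
move=> t /=; rewrite in_itv/= => t01 /negP ts.
have [i si it] := itv_partition_piece s01 t01 ts.
have [_ [v [_ dv]]] := cs i si.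
apply: AP_speed_homothety => //; last exact: (@ex_derive _ _ _ _ _ _ _ (dv t it)).
move: ts; rewrite inE negb_or => /andP[t0 ts]; case/andP: t01 => t0' t1'.
rewrite !lt_neqAle eq_sym t0 t0' t1' !andbT/=.
apply: contraNneq ts => ->.
case: s01 => _ /eqP <-; case: s si {cs it dv} => // x s _.
rewrite /=; exact: mem_last.
Qed.

Lemma mpow_related_joins p c d P Q : p != 0 -> spd P -> spd Q ->
  mpow_related p c d ->
  joins_in_spd P Q c <-> joins_in_spd (mpow P p) (mpow Q p) d.
Proof.
move=> p0 Ppd Qpd cd.
have [c0 d0 d0E c0E] : [/\ spd (c 0), spd (d 0), d 0 = mpow (c 0) p & c 0 = mpow (d 0) p^-1].
  by apply: cd; rewrite lexx ler01.
have [c1 d1 d1E c1E] : [/\ spd (c 1), spd (d 1), d 1 = mpow (c 1) p & c 1 = mpow (d 1) p^-1].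
  by apply: cd; rewrite lexx ler01.
split=> -[e0 e1 _]; split.
- by rewrite d0E e0.
- by rewrite d1E e1.
- by move=> t /cd[].
- by rewrite c0E e0 mpowK// divff.
- by rewrite c1E e1 mpowK// divff.
- by move=> t /cd[].
Qed.

Let two_alpha0 : 2 * alpha != 0.
Proof. by rewrite mulf_neq0// pnatr_eq0. Qed.

(** Each inequality transports a competing curve, by the power 2 alpha or by its
    inverse. *)
Lemma AP_dist_homothety P Q : spd P -> spd Q ->
  (AP_dist 2^-1 (mpow P (2 * alpha)) (mpow Q (2 * alpha)) =
   k%:E * AP_dist alpha P Q)%E.
Proof.
move=> Ppd Qpd; apply/eqP; rewrite eq_le; apply/andP; split.
- rewrite -lee_pdivrMl ?k0//; apply: le_ereal_inf_tmp => _ [c [cj cp] <-].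
  have cd : mpow_related (2 * alpha) c (fun t => mpow (c t) (2 * alpha)).
    by apply: mpow_related_mpow => //; case: cj.
  rewrite lee_pdivrMl ?k0// -(AP_length_homothety cd cp).
  apply: ereal_inf_lbound; eexists; last by [].
  by split; [exact/(mpow_related_joins two_alpha0 Ppd Qpd cd)|exact: mpow_related_piecewise_C1 cd cp].
- apply: le_ereal_inf_tmp => _ [d [dj dp] <-].
  have dc : mpow_related (2 * alpha)^-1 d (fun t => mpow (d t) (2 * alpha)^-1).
    by apply: mpow_related_mpow; [rewrite invr_eq0|case: dj].
  have := mpow_related_sym dc; rewrite invrK => cd.
  have cp := mpow_related_piecewise_C1 dc dp.
  rewrite (AP_length_homothety cd cp) lee_pmul2l ?lte_fin ?k0//.
  apply: ereal_inf_lbound; eexists; last by [].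
  by split=> //; apply/(mpow_related_joins two_alpha0 Ppd Qpd cd).
Qed.

Lemma C1_on_piecewise_C1 c : C1_on 0 1 c -> piecewise_C1 c.
Proof. by move=> cc; exists [:: 1]; [exact: itv_partition1|case]. Qed.

Lemma AP_min_geodesic_homothety P Q c d : spd P -> spd Q ->
  mpow_related (2 * alpha) c d ->
  AP_min_geodesic alpha P Q c <->
  AP_min_geodesic 2^-1 (mpow P (2 * alpha)) (mpow Q (2 * alpha)) d.
Proof.
move=> Ppd Qpd cd; have dc := mpow_related_sym cd.
have speedE t : C1_on 0 1 c -> 0 < t < 1 ->
    AP_speed 2^-1 d t = k * AP_speed alpha c t.
  move=> [_ [v [_ dv]]] t01; apply: AP_speed_homothety => //.
  exact: (@ex_derive _ _ _ _ _ _ _ (dv t t01)).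
have kE : (k^-1%:E * k%:E = 1)%E by rewrite -EFinM mulVf// gt_eqF// k0.
split=> -[j cc [a sa] len]; split.
- exact/(mpow_related_joins two_alpha0 Ppd Qpd cd).
- exact: mpow_related_C1_on cd _ _ cc.
- by exists (k * a) => t t01; rewrite speedE// sa.
- rewrite (AP_length_homothety cd (C1_on_piecewise_C1 cc)) len.
  by rewrite AP_dist_homothety.
- exact/(mpow_related_joins two_alpha0 Ppd Qpd cd).
- exact: mpow_related_C1_on dc _ _ cc.
- exists (k^-1 * a) => t t01.
  have /speedE/(_ t01) : C1_on 0 1 c by exact: mpow_related_C1_on dc _ _ cc.
  by rewrite sa// => ->; rewrite mulKf// gt_eqF// k0.
- have cp : piecewise_C1 c by apply/C1_on_piecewise_C1/(mpow_related_C1_on dc).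
  move: len; rewrite (AP_length_homothety cd cp) AP_dist_homothety// => len.
  by rewrite -[LHS]mul1e -[RHS]mul1e -kE -!muleA len.
Qed.

End Curves.

(** * The theorem *)

Theorem proposition11 (R : realType) (n : nat) (alpha : R)
    (halpha : alpha != 0) (h : 'Sym[R]_n -> R) :
  AP_convex (2^-1) h <->
  AP_convex alpha (fun P : 'Sym[R]_n => h (mpow P (2 * alpha))).
Proof.
have a0 : 2 * alpha != 0 by rewrite mulf_neq0// pnatr_eq0.
split=> [hconv P Q Ppd Qpd c cgeo t t01|Fconv P Q Ppd Qpd d dgeo t t01].
- have cd : mpow_related (2 * alpha) c (fun t => mpow (c t) (2 * alpha)).
    by apply: mpow_related_mpow => //; case: cgeo => -[].
  have dgeo := (AP_min_geodesic_homothety halpha Ppd Qpd cd).1 cgeo.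
  exact: hconv (mpow_spd _ Ppd) (mpow_spd _ Qpd) _ dgeo t t01.
- have dc : mpow_related (2 * alpha)^-1 d (fun t => mpow (d t) (2 * alpha)^-1).
    by apply: mpow_related_mpow; [rewrite invr_eq0|case: dgeo => -[]].
  have := mpow_related_sym dc; rewrite invrK => cd.
  have inv (S : 'Sym[R]_n) : spd S -> mpow (mpow S (2 * alpha)^-1) (2 * alpha) = S.
    by move=> Spd; rewrite mpowK// mulVf.
  have P'pd := mpow_spd (2 * alpha)^-1 Ppd.
  have Q'pd := mpow_spd (2 * alpha)^-1 Qpd.
  have cgeo : AP_min_geodesic alpha (mpow P (2 * alpha)^-1)
      (mpow Q (2 * alpha)^-1) (fun t => mpow (d t) (2 * alpha)^-1).
    by apply/(AP_min_geodesic_homothety halpha P'pd Q'pd cd); rewrite !inv.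
  have := Fconv _ _ P'pd Q'pd _ cgeo t t01.
  by rewrite !inv//; case: dgeo => -[_ _ dpd] _ _ _; exact: dpd.
Qed.
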